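(* Let $v_d(x)=\sum_{k=-d}^d\hat v_ke^{2\pi ikx}$ be a real trigonometric polynomial of degree $d\ge1$ ($\hat v_{-k}=\overline{\hat v_k}$, $\hat v_d\ne0$). For any $\alpha\in\mathbb{R}$, the long-range cocycle $(\alpha,L^{E,d})$, viewed as a one-parameter family in $E\in\mathbb{R}$, is premonotonic, and the $2d$-step cocycle $(2d\alpha,L^{E,d}_{2d})$ is strictly monotonic. More precisely, for any unit vector $v\in\mathbb{C}^{2d}$ and every $x\in\mathbb{T}$, $$0\le\Psi_{L^{E,d}}(v,x)\le1\quad\text{and}\quad0\le\Psi_{A^{E,d}}(v,x)\le1 .$$ Furthermore, for the $2d$-step iterate one has the exact identity $$\Psi_{L^{E,d}_{2d}}(v,x)=\|L^{E,d}_d(x)v\|^2>0 .$$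
   Context: $L^{E,d}(x)$ is the $2d\times2d$ transfer matrix of $\sum_{k=-d}^d\hat v_ku_{n+k}+2\cos(2\pi(x+n\alpha))u_n=Eu_n$: its first row is $\frac1{\hat v_d}(-\hat v_{d-1},\dots,-\hat v_1,\;E-2\cos(2\pi x)-\hat v_0,\;-\hat v_{-1},\dots,-\hat v_{-d})$ (the entry involving $E$ is in column $d$), and for $2\le i\le2d$ its $i$-th row has a single nonzero entry, equal to $1$, in column $i-1$. Iterates: $L^{E,d}_k(x)=L^{E,d}(x+(k-1)\alpha)\cdots L^{E,d}(x+\alpha)L^{E,d}(x)$ for $k\ge1$, and $A^{E,d}(x)=L^{E,d}_d(x)$. $C_d$ is the upper triangular Toeplitz $d\times d$ matrix with $(C_d)_{ij}=\hat v_{d-(j-i)}$ for $j\ge i$ and $0$ otherwise, $S_d=\begin{pmatrix}0&-C_d^*\\C_d&0\end{pmatrix}$ and $\psi_d(u,w)=u^*S_dw$. One has $L^{E,d}(x)^*S_dL^{E,d}(x)=S_d$. For a family $M^E(x)$ of $2d\times2d$ matrices preserving $\psi_d$, $\Psi_{M^E}(v,x)=\psi_d(M^E(x)v,\partial_EM^E(x)v)$. The family is monotonic if $\Psi_{M^E}(v,x)>0$ for every nonzero $\psi_d$-isotropic $v$ ($\psi_d(v,v)=0$) and all $x,E$; a cocycle $(\alpha,M^E)$ is premonotonic if some iterate of it is monotonic. *)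

(* Defs.v *)
From HB Require Import structures.
From mathcomp Require Import all_boot all_order all_algebra.
From mathcomp Require Import spectral.
From mathcomp Require Import all_classical all_reals all_analysis.
From mathcomp Require Import complex.

Set Implicit Arguments.
Unset Strict Implicit.
Unset Printing Implicit Defensive.

Import Order.TTheory GRing.Theory Num.Theory.
Import numFieldNormedType.Exports.

Local Open Scope ring_scope.
Local Open Scope complex_scope.
Local Open Scope sesquilinear_scope.

(* Throughout, C is R[i], [A ^t*] is the conjugate transpose, and inequalities
   between elements of R[i] are those of the numClosedFieldType: [0 <= z] says
   that z is real and nonnegative, so [z <= w] forces Im z = Im w. *)

(* Euclidean norm; the norm [`|v|] on matrices is the sup norm. *)
Definition enorm (R : realType) (n : nat) (v : 'cV[R[i]]_n) : R[i] :=
  sqrtC (\sum_i `|v i 0| ^+ 2).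

(* M E x is the value at the parameter E and the phase x. The circle R/Z is
   represented by 1-periodic functions on R. *)
Definition family (R : realType) (n : nat) := R -> R -> 'M[R[i]]_n.

(* A frequency together with a family; the frequency acts by x |-> x + freq. *)
Record cocycle (R : realType) (n : nat) := Cocycle {
  freq : R;
  fam : family R n }.

Fixpoint iter_fam (R : realType) (n : nat) (alpha : R) (M : family R n)
    (k : nat) (E x : R) : 'M[R[i]]_n :=
  if k is k'.+1 then M E (x + k'%:R * alpha) *m iter_fam alpha M k' E x
  else 1%:M.

Definition iter_cocycle (R : realType) (n : nat) (c : cocycle R n) (k : nat) :
    cocycle R n :=
  Cocycle (k%:R * freq c) (iter_fam (freq c) (fam c) k).

(* Derivative in the real parameter E, taken on the real and imaginary parts
   of each entry. [derive1] is total; differentiability is a separate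
   hypothesis, [derivableE]. *)
Definition dE (R : realType) (n : nat) (M : family R n) : family R n :=
  fun E x => \matrix_(i, j)
    (derive1 (fun e : R => complex.Re (M e x i j)) E
     +i* derive1 (fun e : R => complex.Im (M e x i j)) E).

Definition derivableE (R : realType) (n : nat) (M : family R n) : Prop :=
  forall (E x : R) (i j : 'I_n),
    derivable (fun e : R => complex.Re (M e x i j)) E 1 /\
    derivable (fun e : R => complex.Im (M e x i j)) E 1.

(* The argument of [vhat] is d - (j - i), which lies in [1, d] for i <= j < d. *)
Definition Cmx (R : realType) (d : nat) (vhat : int -> R[i]) : 'M[R[i]]_d :=
  \matrix_(i, j) if (i <= j)%N then vhat (d%:Z - (j%:Z - i%:Z)) else 0.

Definition Smx (R : realType) (d : nat) (vhat : int -> R[i]) :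
    'M[R[i]]_(d + d) :=
  block_mx 0 (- (Cmx d vhat) ^t*) (Cmx d vhat) 0.

Definition psi (R : realType) (d : nat) (vhat : int -> R[i])
    (u w : 'cV[R[i]]_(d + d)) : R[i] :=
  (u ^t* *m Smx d vhat *m w) 0 0.

Definition Psi (R : realType) (d : nat) (vhat : int -> R[i])
    (M : family R (d + d)) (E : R) (v : 'cV[R[i]]_(d + d)) (x : R) : R[i] :=
  psi vhat (M E x *m v) (dE M E x *m v).

(* The families for which Psi is meaningful: well defined on the circle,
   differentiable in E, and preserving psi. *)
Definition psi_family (R : realType) (d : nat) (vhat : int -> R[i])
    (M : family R (d + d)) : Prop :=
  [/\ forall E x : R, M E (x + 1) = M E x,
      derivableE M
    & forall E x : R, (M E x) ^t* *m Smx d vhat *m M E x = Smx d vhat].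

Definition monotonic (R : realType) (d : nat) (vhat : int -> R[i])
    (c : cocycle R (d + d)) : Prop :=
  psi_family vhat (fam c) /\
  forall (E x : R) (v : 'cV[R[i]]_(d + d)),
    v != 0 -> psi vhat v v = 0 -> 0 < Psi vhat (fam c) E v x.

(* Positivity without the restriction to isotropic vectors. *)
Definition strictly_monotonic (R : realType) (d : nat) (vhat : int -> R[i])
    (c : cocycle R (d + d)) : Prop :=
  monotonic vhat c /\
  forall (E x : R) (v : 'cV[R[i]]_(d + d)),
    v != 0 -> 0 < Psi vhat (fam c) E v x.

Definition premonotonic (R : realType) (d : nat) (vhat : int -> R[i])
    (c : cocycle R (d + d)) : Prop :=
  psi_family vhat (fam c) /\
  exists2 k : nat, (0 < k)%N & monotonic vhat (iter_cocycle c k).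

(* Indices start at 0: column j of the first row carries - vhat (d - 1 - j),
   and the energy term sits in column d - 1. *)
Definition transfer (R : realType) (d : nat) (vhat : int -> R[i]) :
    family R (d + d) :=
  fun E x => \matrix_(i, j)
    if i == 0%N :> nat then
      (vhat d%:Z)^-1 *
        ((if j.+1 == d then (E - 2 * cos (2 * pi * x))%:C else 0)
         - vhat (d%:Z - j.+1%:Z))
    else (i == j.+1 :> nat)%:R.

Definition long_range_cocycle (R : realType) (d : nat) (vhat : int -> R[i])
    (alpha : R) : cocycle R (d + d) :=
  Cocycle alpha (transfer d vhat).

(* Main.v *)
Require Import Defs.
From HB Require Import structures.
From mathcomp Require Import all_boot all_order all_algebra.
From mathcomp Require Import spectral.
From mathcomp Require Import all_classical all_reals all_analysis.
From mathcomp Require Import complex.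
From mathcomp Require Import ring zify.

(** The form [psi] is the current of the difference equation. Write a column
    vector as a window v_j = u_(n+d-1-j) of a sequence u. Then [psi] between
    the windows at n of two sequences u and w is the sum, over all bonds
    p < n <= q with q - p <= d, of
    conj(u_p) vhat_(q-p) w_q - conj(u_q) conj(vhat_(q-p)) w_p.
    When n moves to n + 1, the bonds that enter and those that leave all meet
    the site n. If u and w solve the equation, what they contribute adds up to
    zero, because the operator is self-adjoint and the energy E is real: this
    is the invariance of [psi] under the transfer matrix
    ([transfer_preserves]).

    Differentiating the equation in E turns w = dE u into a solution with the
    source u, so the current between u and dE u grows by exactly |u_n|^2 over
    one step: [Psi] of the transfer matrix at a window w is |w_(d-1)|^2
    ([Psi_transfer]). Since [psi] is invariant, the [Psi] of an iterate is the
    sum of the [Psi] of its steps along the orbit ([Psi_iter]), and [Psi] after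
    k steps is therefore the sum of |u_m|^2 over 0 <= m < k.

    The last ingredient is that iterates only shift the window
    ([iter_transfer_shift]). After d steps the sites visited fill the upper
    half of the initial window, which gives the bounds by 1. After 2d steps
    they are exactly the sites of the window reached after d steps, which gives
    the identity with the squared norm of that window; it is nonzero because a
    transfer matrix is injective ([transfer_inj]). *)

Set Implicit Arguments.
Unset Strict Implicit.
Unset Printing Implicit Defensive.

Import Order.TTheory GRing.Theory Num.Theory.
Import numFieldNormedType.Exports.
(* [family] also names a predicate on finite functions. *)
Import Defs.
Local Open Scope ring_scope.
Local Open Scope sesquilinear_scope.

(** * Derivatives of complex matrices in a real parameter *)

Section ComplexDerivative.
Variable R : realType.
Implicit Types (f g : R -> R[i]) (a b : R[i]) (e : R).

Lemma ReD (a b : R[i]) : complex.Re (a + b) = complex.Re a + complex.Re b.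
Proof. by case: a b => [? ?] [? ?]. Qed.

Lemma ImD (a b : R[i]) : complex.Im (a + b) = complex.Im a + complex.Im b.
Proof. by case: a b => [? ?] [? ?]. Qed.

Lemma ReM (a b : R[i]) : complex.Re (a * b) =
  complex.Re a * complex.Re b - complex.Im a * complex.Im b.
Proof. by case: a b => [? ?] [? ?]. Qed.

Lemma ImM (a b : R[i]) : complex.Im (a * b) =
  complex.Re a * complex.Im b + complex.Im a * complex.Re b.
Proof. by case: a b => [? ?] [? ?]. Qed.

(** The parameter is real and the values are complex, so the derivative is that
    of the two real coordinates, as in [dE]. *)
Definition is_deriveC f e a : Prop :=
  is_derive e 1 (fun t : R => complex.Re (f t)) (complex.Re a) /\
  is_derive e 1 (fun t : R => complex.Im (f t)) (complex.Im a).

Lemma is_deriveC_eq f e a b : is_deriveC f e a -> a = b -> is_deriveC f e b.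
Proof. by move=> fa <-. Qed.

Lemma is_deriveC_cst a e : is_deriveC (fun=> a) e 0.
Proof. by split; exact: is_derive_cst. Qed.

Lemma is_deriveC_real (f : R -> R) e l :
  is_derive e 1 f l -> is_deriveC (fun t => (f t)%:C%C) e l%:C%C.
Proof. by move=> fl; split => //=; exact: is_derive_cst. Qed.

Lemma is_deriveCD f g e a b : is_deriveC f e a -> is_deriveC g e b ->
  is_deriveC (fun t => f t + g t) e (a + b).
Proof.
move=> [fr fi] [gr gi]; split.
- under eq_fun do rewrite ReD.
  rewrite ReD; exact: is_deriveD.
- under eq_fun do rewrite ImD.
  rewrite ImD; exact: is_deriveD.
Qed.

Lemma is_deriveCM f g e a b : is_deriveC f e a -> is_deriveC g e b ->
  is_deriveC (fun t => f t * g t) e (a * g e + f e * b).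
Proof.
move=> [fr fi] [gr gi]; split.
- under eq_fun do rewrite ReM.
  apply: (is_derive_eq (is_deriveB (is_deriveM fr gr) (is_deriveM fi gi))).
  rewrite !ReD !ReM /GRing.scale /=; ring.
- under eq_fun do rewrite ImM.
  apply: (is_derive_eq (is_deriveD (is_deriveM fr gi) (is_deriveM fi gr))).
  rewrite !ImD !ImM /GRing.scale /=; ring.
Qed.

Lemma is_deriveC_sum (I : Type) (s : seq I) (F : I -> R -> R[i]) (A : I -> R[i]) e :
  (forall i, is_deriveC (F i) e (A i)) ->
  is_deriveC (fun t => \sum_(i <- s) F i t) e (\sum_(i <- s) A i).
Proof.
move=> FA; elim: s => [|i s IHs].
  under eq_fun do rewrite big_nil.
  rewrite big_nil; exact: is_deriveC_cst.
under eq_fun do rewrite big_cons.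
rewrite big_cons; exact: is_deriveCD.
Qed.

Definition is_deriveCmx m n (M : R -> 'M[R[i]]_(m, n)) e (D : 'M[R[i]]_(m, n)) :=
  forall i j, is_deriveC (fun t => M t i j) e (D i j).

Lemma is_deriveCmx_cst m n (M : 'M[R[i]]_(m, n)) e : is_deriveCmx (fun=> M) e 0.
Proof. by move=> i j; rewrite mxE; exact: is_deriveC_cst. Qed.

Lemma is_deriveCmxM m n p (M : R -> 'M[R[i]]_(m, n)) (N : R -> 'M[R[i]]_(n, p)) e D F :
  is_deriveCmx M e D -> is_deriveCmx N e F ->
  is_deriveCmx (fun t => M t *m N t) e (D *m N e + M e *m F).
Proof.
move=> MD NF i j; under eq_fun do rewrite mxE.
rewrite !mxE -big_split; apply: is_deriveC_sum => k; exact: is_deriveCM.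
Qed.

(** The total function [dE] is a genuine derivative exactly under [derivableE];
    this gives access to the product rule. *)
Lemma is_deriveCmx_dE n (M : family R n) :
  derivableE M <-> forall E x, is_deriveCmx (M^~ x) E (dE M E x).
Proof.
split=> [dM E x i j|dM E x i j].
  rewrite mxE /is_deriveC /= !derive1E; have [? ?] := dM E x i j.
  by split; exact: DeriveDef.
by have [[? _] [? _]] := dM E x i j.
Qed.

Lemma is_deriveCmx_unique n (M : family R n) E x D :
  is_deriveCmx (M^~ x) E D -> dE M E x = D.
Proof.
move=> dM; apply/matrixP => i j; have [dr di] := dM i j.
rewrite mxE !derive1E (@derive_val _ _ _ _ _ _ _ dr) (@derive_val _ _ _ _ _ _ _ di).
by case: (D i j).
Qed.

End ComplexDerivative.

(** * Iterates of a family and the additivity of Psi *)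

Section Iter.
Variables (R : realType) (n : nat) (alpha : R) (M : family R n).

Lemma derivableE_iter k : derivableE M -> derivableE (iter_fam alpha M k).
Proof.
move=> dM; elim: k => [|k IHk] E x i j.
  by split; apply: derivable_cst.
have dM' := (is_deriveCmx_dE M).1 dM; have dI := (is_deriveCmx_dE _).1 IHk.
have [[? _] [? _]] := is_deriveCmxM (dM' E (x + k%:R * alpha)) (dI E x) i j.
by split.
Qed.

Lemma dE_iterS k E x : derivableE M ->
  dE (iter_fam alpha M k.+1) E x =
    dE M E (x + k%:R * alpha) *m iter_fam alpha M k E x +
    M E (x + k%:R * alpha) *m dE (iter_fam alpha M k) E x.
Proof.
move=> dM; apply: is_deriveCmx_unique.
apply: is_deriveCmxM; first exact: ((is_deriveCmx_dE M).1 dM).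
exact: ((is_deriveCmx_dE _).1 (derivableE_iter k dM)).
Qed.

Lemma dE_iter0 E x : dE (iter_fam alpha M 0) E x = 0.
Proof. exact/is_deriveCmx_unique/is_deriveCmx_cst. Qed.

End Iter.

Section PsiFamily.
Variables (R : realType) (d : nat) (vhat : int -> R[i]) (alpha : R).

Lemma psiDr (u w w' : 'cV[R[i]]_(d + d)) :
  psi vhat u (w + w') = psi vhat u w + psi vhat u w'.
Proof. by rewrite /psi mulmxDr mxE. Qed.

Lemma psi0r (u : 'cV[R[i]]_(d + d)) : psi vhat u 0 = 0.
Proof. by rewrite /psi mulmx0 mxE. Qed.

Variable M : family R (d + d).
Hypothesis MF : psi_family vhat M.

Lemma psi_family_iter k : psi_family vhat (iter_fam alpha M k).
Proof.
have [per der inv] := MF; split; last 2 first.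
- exact: derivableE_iter.
- move=> E x; elim: k => [|k IHk] /=.
    by rewrite trmx1 map_mx1 mul1mx mulmx1.
  rewrite trmx_mul map_mxM /= -!mulmxA.
  rewrite (mulmxA (Smx _ _)) (mulmxA (_ ^t*) (_ *m _)).
  by rewrite (mulmxA (_ ^t*) (Smx _ _)) inv mulmxA.
move=> E x; elim: k => [|k IHk] //=.
by rewrite addrAC per IHk.
Qed.

Lemma psi_invariant E x u w : psi vhat (M E x *m u) (M E x *m w) = psi vhat u w.
Proof.
have [_ _ inv] := MF.
rewrite /psi trmx_mul map_mxM -[in RHS](inv E x).
by rewrite !mulmxA.
Qed.

(** The product rule splits the derivative of the iterate in two terms. In one
    only the last step is differentiated; in the other the last step acts on
    both arguments of [psi] and cancels by invariance. *)
Lemma Psi_iterS k E v x :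
  Psi vhat (iter_fam alpha M k.+1) E v x =
    Psi vhat M E (iter_fam alpha M k E x *m v) (x + k%:R * alpha) +
    Psi vhat (iter_fam alpha M k) E v x.
Proof.
have [_ der _] := MF.
by rewrite /Psi dE_iterS // mulmxDl psiDr /= -!mulmxA psi_invariant.
Qed.

Lemma Psi_iter k E v x :
  Psi vhat (iter_fam alpha M k) E v x =
  \sum_(m < k) Psi vhat M E (iter_fam alpha M m E x *m v) (x + m%:R * alpha).
Proof.
elim: k => [|k IHk]; last by rewrite big_ord_recr Psi_iterS IHk addrC.
by rewrite big_ord0 /Psi dE_iter0 mul0mx psi0r.
Qed.

End PsiFamily.

(** * Euclidean norm *)

Lemma enorm_sqr (R : realType) n (v : 'cV[R[i]]_n) : enorm v ^+ 2 = \sum_i `|v i 0| ^+ 2.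
Proof. exact: sqrtCK. Qed.

Lemma enorm_sqr_gt0 (R : realType) n (v : 'cV[R[i]]_n) : v != 0 -> 0 < enorm v ^+ 2.
Proof.
move=> v0; have s_ge0 : 0 <= \sum_i `|v i 0| ^+ 2.
  by apply: sumr_ge0 => i _; exact: exprn_ge0.
rewrite enorm_sqr lt_neqAle s_ge0 andbT eq_sym; apply: contra v0.
rewrite psumr_eq0 => [|i _]; last exact: exprn_ge0.
move=> /allP v0; apply/eqP/matrixP => i o; rewrite ord1 mxE.
by apply/eqP; have := v0 i (mem_index_enum _); rewrite /= expf_eq0 normr_eq0.
Qed.

(** * The transfer matrix and the current *)

Lemma sum_delta (K : pzRingType) n (F : nat -> K) k :
  \sum_(i < n) F i * (i == k :> nat)%:R = if (k < n)%N then F k else 0.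
Proof.
case: ifP => [kn|nk].
  rewrite (bigD1 (Ordinal kn)) //= eqxx mulr1 big1 ?addr0 // => i.
  by rewrite -val_eqE => /negPf /= ->; rewrite mulr0.
rewrite big1 // => i _; case: eqP => [ik|]; last by rewrite mulr0.
by have := ltn_ord i; rewrite ik nk.
Qed.

Section Transfer.
Variables (R : realType) (d : nat) (vhat : int -> R[i]).

Let L := transfer d vhat.

(** The entries of [Smx] in a form free of blocks: the bond between a and b, if
    of length at most d, contributes when it crosses the cut between d - 1 and
    d, with the sign of the crossing. Defined on all natural numbers, it can be
    compared with its own shift. *)
Definition flux (a b : nat) : R[i] :=
  ((d <= a)%N%:R - (d <= b)%N%:R) *
  (if `|a%:Z - b%:Z| <= d%:Z then vhat (a%:Z - b%:Z) else 0).

(** Past the last coordinate no bond of length at most d crosses the cut. Hence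
    the subdiagonal of ones in the transfer matrix can be treated as the shift
    of all natural numbers, with no boundary term. *)
Lemma flux_outl b : (b <= d + d)%N -> flux (d + d) b = 0.
Proof.
move=> bdd; rewrite /flux leq_addr; have [db|bd] := leqP d b.
  by rewrite subrr mul0r.
by rewrite ifF ?mulr0 //; apply/negP; lia.
Qed.

Lemma flux_outr a : (a <= d + d)%N -> flux a (d + d) = 0.
Proof.
move=> add; rewrite /flux leq_addr; have [da|ad] := leqP d a.
  by rewrite subrr mul0r.
by rewrite ifF ?mulr0 //; apply/negP; lia.
Qed.

(** The shift moves only the coordinate d - 1 across the cut, so only the bonds
    with an end there change. *)
Lemma fluxSS (i j : nat) : (i < d + d)%N -> (j < d + d)%N ->
  flux i.+1 j.+1 =
    flux i j + ((i.+1 == d)%:R - (j.+1 == d)%:R) * vhat (i%:Z - j%:Z).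
Proof.
move=> id jd; rewrite /flux.
have -> : i.+1%:Z - j.+1%:Z = i%:Z - j%:Z by lia.
have S k : (d <= k.+1)%N%:R = (d <= k)%N%:R + (k.+1 == d)%:R :> R[i].
  by rewrite leq_eqVlt ltnS eq_sym; case: eqP => [<-|]; rewrite ?ltnn ?add0r ?addr0.
rewrite !S; case: ifP => [_|far]; first by ring.
rewrite !mulr0 add0r.
(* The coordinate d - 1 is within distance d of every coordinate. *)
have -> : (i.+1 == d) = false by lia.
have -> : (j.+1 == d) = false by lia.
by rewrite subrr mul0r.
Qed.

Definition top_row E x j : R[i] := (vhat d%:Z)^-1 *
  ((if j.+1 == d then (E - 2 * cos (2 * pi * x))%:C%C else 0) - vhat (d%:Z - j.+1%:Z)).

Lemma transferE E x (i j : 'I_(d + d)) :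
  L E x i j = top_row E x j * (i == 0 :> nat)%:R + (i == j.+1 :> nat)%:R.
Proof.
by rewrite mxE /top_row; case: eqP => [->|_]; rewrite ?mulr1 ?addr0 ?mulr0 ?add0r.
Qed.

Lemma transfer_shift E x (w : 'cV_(d + d)) (p q : 'I_(d + d)) : q = p.+1 :> nat ->
  (L E x *m w) q 0 = w p 0.
Proof.
move=> qp; rewrite mxE (bigD1 p) //= big1 ?addr0 => [|j jp].
  by rewrite transferE qp eqxx mulr0 add0r mul1r.
by rewrite transferE qp eqSS (eq_sym (p : nat)) val_eqE (negPf jp) mulr0 addr0 mul0r.
Qed.

Lemma is_deriveCmx_transfer E x : is_deriveCmx (L^~ x) E
  (\matrix_(i, j) ((vhat d%:Z)^-1 * (j.+1 == d)%:R * (i == 0 :> nat)%:R)).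
Proof.
move=> i j; under eq_fun do rewrite transferE /top_row.
set c := 2 * cos _.
have dpot : is_deriveC
    (fun t : R => if j.+1 == d then (t - c)%:C%C else 0) E (j.+1 == d)%:R.
  case: eqP => _; last exact: is_deriveC_cst.
  apply: is_deriveC_real.
  apply: is_derive_eq (is_deriveB (is_derive_id _ _) (is_derive_cst _ _ _)) _.
  by rewrite subr0.
apply: is_deriveC_eq.
  apply: is_deriveCD (is_deriveC_cst _ _).
  apply: is_deriveCM (is_deriveC_cst _ _).
  apply: is_deriveCM (is_deriveC_cst _ _) _.
  exact: is_deriveCD dpot (is_deriveC_cst _ _).
by rewrite mxE mul0r !mulr0 add0r !addr0.
Qed.

Hypothesis d_gt0 : (0 < d)%N.

Lemma flux_0l b : flux 0 b = - vhat (- d%:Z) * (b == d)%:R.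
Proof.
rewrite /flux leqNgt d_gt0 sub0r sub0r normrN.
have [db|bd] := leqP d b; last by rewrite oppr0 mul0r ltn_eqF // mulr0.
rewrite mulN1r ger0_norm // lez_nat leq_eqVlt ltnNge db orbF.
by case: eqP => [->|_]; rewrite ?mulr1 ?mulr0 ?oppr0.
Qed.

Lemma flux_0r a : flux a 0 = vhat d%:Z * (a == d)%:R.
Proof.
rewrite /flux [(d <= 0)%N]leqNgt d_gt0 !subr0.
have [da|ad] := leqP d a; last by rewrite mul0r ltn_eqF // mulr0.
rewrite mul1r ger0_norm // lez_nat leq_eqVlt ltnNge da orbF.
by case: eqP => [->|_]; rewrite ?mulr1 ?mulr0.
Qed.

Lemma sum_transfer E x (F : nat -> R[i]) (j : 'I_(d + d)) : F (d + d)%N = 0 ->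
  \sum_(i < d + d) F i * L E x i j = F 0 * top_row E x j + F j.+1.
Proof.
move=> F_out; under eq_bigr do rewrite transferE mulrDr mulrCA mulrA.
rewrite big_split /= sum_delta.
rewrite (sum_delta _ (fun i => top_row E x j * F i)) ifT ?addn_gt0 ?d_gt0 //.
rewrite mulrC; congr (_ + _); case: ltnP => // jd.
have -> : j.+1 = (d + d)%N by have := ltn_ord j; lia.
by rewrite F_out.
Qed.

Lemma site_subproof : (d.-1 < d + d)%N.
Proof. by rewrite prednK // leq_addr. Qed.

(** In a window v_j = u_(n+d-1-j), the coordinate that holds u_n. *)
Definition site : 'I_(d + d) := Ordinal site_subproof.

Hypothesis vhat_real :
  forall k : int, `|k| <= d%:Z -> vhat (- k) = Num.conj (vhat k).

Lemma Smx_flux (a b : 'I_(d + d)) : Smx d vhat a b = flux a b.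
Proof.
rewrite /Smx /flux mxE; case: splitP => i ai; rewrite mxE; case: splitP => j bj;
  rewrite !mxE ai bj.
- by rewrite [(d <= i)%N]leqNgt [(d <= j)%N]leqNgt !ltn_ord subrr mul0r.
- rewrite [(d <= i)%N]leqNgt ltn_ord leq_addr sub0r mulN1r /=; congr (- _).
  have -> : (`|i%:Z - (d + j)%N%:Z| <= d%:Z) = (j <= i)%N by have := ltn_ord i; lia.
  case: leqP => // ji; last by rewrite conjC0.
  by have id := ltn_ord i; rewrite -vhat_real; [congr vhat|]; lia.
- rewrite leq_addr [(d <= j)%N]leqNgt ltn_ord subr0 mul1r.
  have -> : (`|(d + i)%N%:Z - j%:Z| <= d%:Z) = (i <= j)%N by have := ltn_ord j; lia.
  by case: leqP => // ij; congr vhat; lia.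
- by rewrite !leq_addr subrr mul0r.
Qed.

Hypothesis vhat_d_neq0 : vhat d%:Z != 0.

Lemma vhatN_d_neq0 : vhat (- d%:Z) != 0.
Proof. by rewrite vhat_real ?conjC_eq0 // lerr. Qed.

(** Each column of the transfer matrix combines the shift with the top row.
    In the entry (i, j) of the product, the shift moves [flux] from (i, j) to
    (i+1, j+1), while the top row only meets the bond between 0 and d,
    whose weight cancels the denominator of that row. *)
Lemma transfer_preserves E x : (L E x) ^t* *m Smx d vhat *m L E x = Smx d vhat.
Proof.
apply/matrixP => i j; rewrite Smx_flux.
have contract_rows b : (b <= d + d)%N -> \sum_(a < d + d) (flux a b)^* * L E x a i
    = (flux 0 b)^* * top_row E x i + (flux i.+1 b)^*.
  move=> bd; rewrite (sum_transfer E x (F := fun a => (flux a b)^*)) //.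
  by rewrite flux_outl // conjC0.
transitivity (\sum_(b < d + d)
  (flux 0 b * (top_row E x i)^* + flux i.+1 b) * L E x b j).
  rewrite mxE; apply: eq_bigr => b _; congr (_ * _).
  rewrite mxE -[RHS]conjCK rmorphD rmorphM /= conjCK -contract_rows; last first.
    exact/ltnW/ltn_ord.
  rewrite rmorph_sum; apply: eq_bigr => a _.
  by rewrite rmorphM /= conjCK Smx_flux !mxE mulrC.
rewrite (sum_transfer E x
  (F := fun b => flux 0 b * (top_row E x i)^* + flux i.+1 b)); last first.
  by rewrite !flux_outr ?mul0r ?addr0 ?ltn_ord.
rewrite /= !flux_0l flux_0r fluxSS ?ltn_ord //.
rewrite [(0 == d)%N]eq_sym gtn_eqF // mulr0 mul0r add0r.
have top_i : vhat (- d%:Z) * (top_row E x i)^* =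
    (if i.+1 == d then (E - 2 * cos (2 * pi * x))%:C%C else 0) - vhat (i.+1%:Z - d%:Z).
  rewrite vhat_real ?lerr // /top_row rmorphM fmorphV /= mulVKf ?conjC_eq0 //.
  rewrite rmorphB /= -vhat_real; last by have := ltn_ord i; lia.
  by rewrite opprB; congr (_ - _); case: ifP => _; rewrite ?conjC0 //; exact: conjc_real.
have top_j : vhat d%:Z * top_row E x j =
    (if j.+1 == d then (E - 2 * cos (2 * pi * x))%:C%C else 0) - vhat (d%:Z - j.+1%:Z).
  by rewrite /top_row mulVKf.
(* The energy terms cancel, E being real, and the hopping terms of the top row
   compensate the bonds that change under the shift. *)
rewrite (mulrAC (vhat _)) top_j (mulrAC (- _)) 2!mulNr top_i.
case: (i.+1 =P d) => [id|_]; case: (j.+1 =P d) => [jd|_]; rewrite /= ?mulr0 ?mulr1.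
- have -> : i.+1%:Z - d%:Z = 0 by lia.
  have -> : d%:Z - j.+1%:Z = 0 by lia.
  by ring.
- have -> : d%:Z - j.+1%:Z = i%:Z - j%:Z by lia.
  by ring.
- have -> : i.+1%:Z - d%:Z = i%:Z - j%:Z by lia.
  by ring.
- by ring.
Qed.

Lemma transfer_psi_family : psi_family vhat L.
Proof.
split; [|apply/is_deriveCmx_dE => E x|exact: transfer_preserves].
- move=> E x; apply/matrixP => i j; rewrite !mxE.
  have -> : 2 * pi * (x + 1) = 2 * pi * x + pi *+ 2 by ring.
  by rewrite cosD2pi.
- rewrite (is_deriveCmx_unique (is_deriveCmx_transfer E x)); exact: is_deriveCmx_transfer.
Qed.

(** Only the site n is differentiated in E, and it enters through the new
    coordinate 0. The form pairs that coordinate with the coordinate d alone,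
    into which the step has just moved the value at n; the weight of the pair
    cancels the denominator. *)
Lemma Psi_transfer E x (w : 'cV_(d + d)) : Psi vhat L E w x = `|w site 0| ^+ 2.
Proof.
have zd : (0 < d + d)%N by rewrite addn_gt0 d_gt0.
have dd : (d < d + d)%N by lia.
have dLw : dE L E x *m w = (w site 0 / vhat d%:Z) *: delta_mx (Ordinal zd) 0.
  rewrite (is_deriveCmx_unique (is_deriveCmx_transfer E x)).
  apply/matrixP => i o; rewrite ord1 !mxE (bigD1 site) //= big1 ?addr0 => [|j jp].
    rewrite !mxE prednK // eqxx mulr1 andbT -val_eqE /=; ring.
  rewrite !mxE (_ : (j.+1 == d) = false) ?mulr0 ?mul0r //.
  by apply: contraNF jp => /eqP jd; apply/eqP/val_inj => /=; lia.
rewrite /Psi /psi dLw -scalemxAr mxE -colE mxE mxE (bigD1 (Ordinal dd)) //=.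
rewrite big1 => [|j jd]; last first.
  rewrite Smx_flux flux_0r (_ : (j == d :> nat) = false) ?mulr0 //.
  exact: contraNF jd.
rewrite addr0 Smx_flux flux_0r eqxx mulr1 2!mxE (@transfer_shift _ _ _ site) /=.
  by rewrite mulrA mulrAC divfK // normCK.
by rewrite prednK.
Qed.

Lemma transfer_inj E x (w : 'cV_(d + d)) : L E x *m w = 0 -> w = 0.
Proof.
move=> Lw0; have w0 (p : 'I_(d + d)) : (p.+1 < d + d)%N -> w p 0 = 0.
  by move=> pd; rewrite -(@transfer_shift E x w p (Ordinal pd)) // Lw0 mxE.
have zd : (0 < d + d)%N by rewrite addn_gt0 d_gt0.
apply/matrixP => p o; rewrite ord1 mxE {o}.
have [/w0 //|pd] := ltnP p.+1 (d + d).
have {}pd : p.+1 = (d + d)%N by have := ltn_ord p; lia.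
have : (L E x *m w) (Ordinal zd) 0 = 0 by rewrite Lw0 mxE.
rewrite mxE (bigD1 p) //= big1 ?addr0 => [|j jp]; last first.
  rewrite w0 ?mulr0 //; move: jp; rewrite -val_eqE /=; have := ltn_ord j; lia.
(* The last coordinate survives only in the top row, with weight vhat (- d). *)
rewrite transferE /= mulr1 addr0 /top_row pd ifF; last by apply/eqP; lia.
have -> : d%:Z - (d + d)%N%:Z = - d%:Z by lia.
by move/eqP; rewrite !mulf_eq0 invr_eq0 sub0r oppr_eq0 (negPf vhat_d_neq0)
  (negPf vhatN_d_neq0) => /eqP.
Qed.

Variable alpha : R.

(** After m steps the coordinate p holds u_(m+d-1-p), so coordinates with the
    same m - p hold the same site. *)
Lemma iter_transfer_shift m k E x (v : 'cV_(d + d)) (p q : 'I_(d + d)) :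
    (m <= k)%N -> (q + m = k + p)%N ->
  (iter_fam alpha L k E x *m v) q 0 = (iter_fam alpha L m E x *m v) p 0.
Proof.
move=> mk; rewrite -(subnKC mk); elim: (k - m)%N q => {k mk} [|i IHi] q qp.
  by rewrite addn0 (val_inj (_ : val q = val p)) //=; lia.
have ipd : (i + p < d + d)%N by have := ltn_ord q; lia.
rewrite addnS /= -mulmxA (@transfer_shift _ _ _ (Ordinal ipd)) /=; last by lia.
by apply: IHi => /=; lia.
Qed.

Lemma iter_transfer_inj k E x (v : 'cV_(d + d)) :
  iter_fam alpha L k E x *m v = 0 -> v = 0.
Proof.
by elim: k => [|k IHk] /=; [rewrite mul1mx | rewrite -mulmxA => /transfer_inj/IHk].
Qed.

Lemma Psi_iter_transfer k E x v : Psi vhat (iter_fam alpha L k) E v x =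
  \sum_(m < k) `|(iter_fam alpha L m E x *m v) site 0| ^+ 2.
Proof.
rewrite (Psi_iter alpha transfer_psi_family).
by apply: eq_bigr => m _; rewrite Psi_transfer.
Qed.

(** The sites 0, ..., d - 1 fill the upper half of the initial window, in
    reverse order. *)
Lemma Psi_iter_transfer_d E x v : Psi vhat (iter_fam alpha L d) E v x =
  \sum_(i < d) `|v (lshift d i) 0| ^+ 2.
Proof.
rewrite Psi_iter_transfer (reindex_inj rev_ord_inj) /=.
apply: eq_bigr => i _; have id := ltn_ord i.
by rewrite (@iter_transfer_shift 0 _ _ _ _ (lshift d i)) /= ?mul1mx //; lia.
Qed.

(** The sites 0, ..., 2d - 1, visited in this order during 2d steps, are those
    of the window at time d, read from its last coordinate. *)
Lemma Psi_iter_transfer_2d E x v : Psi vhat (iter_fam alpha L (2 * d)) E v x =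
  enorm (iter_fam alpha L d E x *m v) ^+ 2.
Proof.
rewrite enorm_sqr Psi_iter_transfer mul2n -addnn (reindex_inj rev_ord_inj) /=.
apply: eq_bigr => q _; congr (`|_| ^+ 2); have qd := ltn_ord q.
(* Coordinate q at time d is the current site of time 2d - 1 - q, which comes
   before d or not according to q. *)
have [dq|dq] := leqP d q.
  by rewrite [RHS](@iter_transfer_shift (d + d - q.+1) _ _ _ _ site) //=; lia.
by rewrite (@iter_transfer_shift d _ _ _ _ q) //=; lia.
Qed.

End Transfer.

(** * Monotonicity of the long-range cocycle *)

Theorem lemma5p9 (R : realType) (d : nat) (vhat : int -> R[i]) (alpha : R)
    (d_gt0 : (0 < d)%N)
    (vhat_real : forall k : int, `|k| <= d%:Z -> vhat (- k) = Num.conj (vhat k))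
    (vhat_d_neq0 : vhat d%:Z != 0) :
  let L := transfer d vhat in
  let A := iter_fam alpha L d in
  let c := long_range_cocycle d vhat alpha in
  [/\ premonotonic vhat c,
      strictly_monotonic vhat (iter_cocycle c (2 * d)),
      (forall (E x : R) (v : 'cV[R[i]]_(d + d)), enorm v = 1 ->
         0 <= Psi vhat L E v x <= 1 /\ 0 <= Psi vhat A E v x <= 1)
    & (forall (E x : R) (v : 'cV[R[i]]_(d + d)), enorm v = 1 ->
         Psi vhat (iter_fam alpha L (2 * d)) E v x
           = enorm (iter_fam alpha L d E x *m v) ^+ 2 /\
         0 < enorm (iter_fam alpha L d E x *m v) ^+ 2)].
Proof.
move=> L A c.
have LF : psi_family vhat L by exact: transfer_psi_family.
have norm_gt0 E x v : v != 0 -> 0 < enorm (iter_fam alpha L d E x *m v) ^+ 2.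
  move=> v0; apply: enorm_sqr_gt0; apply: contra v0 => /eqP.
  by move/(iter_transfer_inj d_gt0 vhat_real vhat_d_neq0)/eqP.
have Psi_gt0 E x v : v != 0 -> 0 < Psi vhat (iter_fam alpha L (2 * d)) E v x.
  by move=> v0; rewrite Psi_iter_transfer_2d // norm_gt0.
have strict : strictly_monotonic vhat (iter_cocycle c (2 * d)).
  split; last by move=> E x v; exact: Psi_gt0.
  by split; [exact: psi_family_iter | move=> E x v v0 _; exact: Psi_gt0].
have sum_sq_ge0 (I : finType) (P : pred I) (F : I -> R[i]) :
    0 <= \sum_(i | P i) `|F i| ^+ 2 by apply: sumr_ge0 => i _; exact: exprn_ge0.
split=> //.
- by split=> //; exists (2 * d)%N; [rewrite muln_gt0 d_gt0 | case: strict].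
- move=> E x v v1.
  have {}v1 : \sum_i `|v i 0| ^+ 2 = 1 by rewrite -enorm_sqr v1 expr1n.
  split.
    rewrite Psi_transfer // exprn_ge0 //= -v1 (bigD1 (site d_gt0)) //=.
    by rewrite lerDl.
  by rewrite Psi_iter_transfer_d // sum_sq_ge0 -v1 big_split_ord /= lerDl.
- move=> E x v v1; split; first exact: Psi_iter_transfer_2d.
  apply: norm_gt0; apply/eqP => v0; move: v1; rewrite v0 /enorm big1 ?sqrtC0.
    by move/esym/eqP; rewrite oner_eq0.
  by move=> i _; rewrite mxE normr0 expr0n.
Qed.
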